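(* Let $\gamma>0$ and let $F=G$ be the generalized Gaussian distribution with parameter $\gamma$, i.e. with density $f(x)\propto\exp(-|x|^\gamma/\gamma)$, $x\in\mathbb{R}$. Let $\varepsilon_n=n^{-\beta}$ with $0<\beta<1/2$ fixed, and $\mu_n=n^{s-1/2}$ with $s\in(0,1/2)$ fixed. Then the hypotheses $H_0^n$ and $H_1^n$ merge asymptotically when either $\gamma\ge 1/2$ and $s<\beta$, or $\gamma<1/2$ and $s<\frac12-\frac{1-2\beta}{1+2\gamma}$.
   Context: Testing problem: for each $n$ one observes $X_1,\dots,X_n\in\mathbb{R}$ and tests $H_0^n$: $X_1,\dots,X_n$ are i.i.d. with distribution function $F(x)$, versus $H_1^n$: $X_1,\dots,X_n$ are i.i.d. with distribution function $(1-\varepsilon_n)F(x)+\varepsilon_n G(x-\mu_n)$. The hypotheses merge asymptotically if the total variation distance between the joint distributions of $(X_1,\dots,X_n)$ under $H_0^n$ and under $H_1^n$ tends to $0$ as $n\to\infty$ (equivalently, the minimal sum of type I and type II error probabilities over all tests tends to $1$). *)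

(* Defs.v *)
From HB Require Import structures.
From mathcomp Require Import all_boot all_order all_algebra.
From mathcomp Require Import all_classical all_reals all_analysis.

Set Implicit Arguments.
Unset Strict Implicit.
Unset Printing Implicit Defensive.
Import Order.TTheory GRing.Theory Num.Theory.
Import numFieldNormedType.Exports.

Local Open Scope classical_set_scope.
Local Open Scope ring_scope.

(* Normalised as the largest discrepancy over events (values in [0, 1]). *)
Definition tv_dist d (T : measurableType d) (R : realType)
    (P Q : probability T R) : \bar R :=
  ereal_sup [set `|P A - Q A|%E | A in (measurable : set (set T))].

(* Q is the joint distribution of n i.i.d. real random variables with
   distribution function H; they are realised as the coordinates of R^n.
   Taking A i = setT outside a subfamily, the product rule below covers every
   subfamily of the coordinates. *)
Definition iid_joint_law (R : realType) (n : nat) (H : R -> R)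
    (Q : probability (n.-tuple R) R) : Prop :=
  (forall (i : 'I_n) (x : R), Q [set t | tnth t i <= x] = (H x)%:E) /\
  (forall A : 'I_n -> set R, (forall i, measurable (A i)) ->
     Q [set t | forall i, A i (tnth t i)] =
     (\prod_(i < n) Q [set t | A i (tnth t i)])%E).

Definition mixture_cdf (R : realType) (F G : R -> R) (eps mu x : R) : R :=
  (1 - eps) * F x + eps * G (x - mu).

Definition merge_asymptotically (R : realType) (F G : R -> R)
    (eps mu : nat -> R) : Prop :=
  forall Q0 Q1 : forall n : nat, probability (n.-tuple R) R,
    (forall n, (0 < n)%N -> iid_joint_law F (Q0 n)) ->
    (forall n, (0 < n)%N ->
       iid_joint_law (mixture_cdf F G (eps n) (mu n)) (Q1 n)) ->
    tv_dist (Q0 n) (Q1 n) @[n --> \oo] --> 0%E.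

Definition gen_gauss_fun (R : realType) (gamma x : R) : R :=
  expR (- (`|x| `^ gamma / gamma)).

Definition gen_gauss_pdf (R : realType) (gamma x : R) : R :=
  gen_gauss_fun gamma x / \int[lebesgue_measure]_y gen_gauss_fun gamma y.

Definition gen_gauss_cdf (R : realType) (gamma x : R) : R :=
  \int[lebesgue_measure]_(y in `]-oo, x]) gen_gauss_pdf gamma y.

(* Main.v *)
(* The total variation distance between the two n-fold products is bounded
   through the chi-square divergence, which tensorizes: it is at most
   e / 2 + ((1 + c) ^ n - 1) / (2 e) for every e > 0, where
   c = eps ^ 2 \int (f (x - mu) - f x) ^ 2 / f x dx.
   For every p < min(1, 1/2 + gamma) the last integral is O(mu ^ (2 p)): up to
   an integrable exponential factor the integrand is the square of
   (|x| ^ gamma - |x - mu| ^ gamma) / gamma = O(mu ^ p (|x| ^ (gamma - p) + 1)),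
   and |x| ^ (2 (gamma - p)) is integrable at 0.  So n c tends to 0 as soon as
   1 - 2 beta < (1 - 2 s) p, and in both regions such a p exists. *)
Require Import Defs.
From HB Require Import structures.
From mathcomp Require Import all_boot all_order all_algebra.
From mathcomp Require Import all_classical all_reals all_analysis.
From mathcomp Require Import measurable_realfun ring lra.
Import Order.TTheory GRing.Theory Num.Theory.
Import numFieldNormedType.Exports.
Local Open Scope classical_set_scope.
Local Open Scope ring_scope.

Set Implicit Arguments.
Unset Strict Implicit.
Unset Printing Implicit Defensive.

(** * Densities and independent coordinates *)

(** The laws [Q0] and [Q1] are arbitrary probabilities on tuples, known only through their marginal
    distribution functions and the product rule on rectangles. Factorization of expectations, and
    the density of [Q1] with respect to [Q0], have to be recovered from these data alone. The bound
    with a free [e] is Cauchy-Schwarz in linearised form: it keeps every estimate polynomial in the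
    likelihood ratio, and the optimal [e], a square root, is inserted only in the final limit. The
    delicate point in the chi-square integral is the tail: [f (x - mu) ^ 2 / f x] has exponent [(|x|
    ^ gamma - 2 |x - mu| ^ gamma) / gamma], and a decaying factor must be extracted from it
    uniformly in [mu], for every [gamma]. Only [0 < mu <= 1] is used for this. *)

Section density_measure.
Local Open Scope ereal_scope.
Context d (T : measurableType d) (R : realType).
Variables (mu : {measure set T -> \bar R}) (g : T -> R).
Hypotheses (mg : measurable_fun [set: T] g) (g_ge0 : forall x, (0 <= g x)%R).

(** The two proofs are arguments so that the measure structure declared below can be inferred from
    the term itself. *)
Definition density_measure of measurable_fun [set: T] g &
    (forall x, (0 <= g x)%R) := fun A => \int[mu]_(x in A) (g x)%:E.

Local Notation nu := (density_measure mg g_ge0).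

Let nu0 : nu set0 = 0. Proof. exact: integral_set0. Qed.

Let nu_ge0 A : 0 <= nu A.
Proof. by apply: integral_ge0 => x _; rewrite lee_fin. Qed.

Let nu_sigma_additive : semi_sigma_additive nu.
Proof.
move=> F mF tF mUF; rewrite /density_measure; apply: cvg_toP.
  apply: ereal_nondecreasing_is_cvgn => m n mn.
  by apply: lee_sum_nneg_natr => // k _ _; exact: nu_ge0.
rewrite ge0_integral_bigcup//=.
- exact/measurable_funTS/measurable_EFinP.
- by move=> x _; rewrite lee_fin.
Qed.

HB.instance Definition _ := isMeasure.Build _ _ _ nu nu0 nu_ge0 nu_sigma_additive.

Import HBNNSimple.

(** Monotone convergence along the simple approximations [h n] reduces both sides to simple
    functions; these are sums over level sets, and on the indicator of a level set the identity is
    the definition of [nu]. *)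
Lemma ge0_integral_density_measure (f : T -> \bar R) :
  measurable_fun [set: T] f -> (forall x, 0 <= f x) ->
  \int[nu]_x f x = \int[mu]_x (f x * (g x)%:E).
Proof.
move=> mf f0; pose h := nnsfun_approx measurableT mf.
have cvgh x : (h n x)%:E @[n --> \oo] --> f x by exact: cvg_nnsfun_approx.
have ndh x : {homo (fun n => (h n x)%:E) : a b / (a <= b)%N >-> a <= b}.
  by move=> a b ab; rewrite lee_fin; exact/lefP/nd_nnsfun_approx.
have -> : \int[nu]_x f x = limn (fun n => \int[nu]_x (h n x)%:E).
  under eq_integral do rewrite -(cvg_lim (@ereal_hausdorff R) (cvgh _)).
  apply: monotone_convergence => //.
  - by move=> n; exact/measurable_EFinP.
  - by move=> n x _; rewrite lee_fin.
have -> : \int[mu]_x (f x * (g x)%:E) =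
    limn (fun n => \int[mu]_x ((h n x)%:E * (g x)%:E)).
  have cvghg x : (h n x)%:E * (g x)%:E @[n --> \oo] --> f x * (g x)%:E.
    exact: cvgeZr.
  under eq_integral do rewrite -(cvg_lim (@ereal_hausdorff R) (cvghg _)).
  apply: monotone_convergence => //.
  - by move=> n; apply: emeasurable_funM; exact/measurable_EFinP.
  - by move=> n x _; rewrite mule_ge0 ?lee_fin.
  - by move=> x _ a b ab; rewrite lee_wpmul2r ?lee_fin//; exact/lefP/nd_nnsfun_approx.
congr (limn _); apply/funext => n.
have hE x : (h n x)%:E =
    \sum_(y \in range (h n)) (y * \1_(h n @^-1` [set y]) x)%:E.
  by rewrite fimfunE -fsumEFin.
have indich r : measurable_fun setT (fun x => (r * \1_(h n @^-1` [set r]) x)%:E).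
  by apply/measurable_EFinP; exact: measurable_funM.
under [LHS]eq_integral do rewrite hE.
rewrite ge0_integral_fsum//; last by move=> y x _; exact: nnfun_muleindic_ge0.
transitivity (\int[mu]_x (\sum_(y \in range (h n))
    (y * \1_(h n @^-1` [set y]) x)%:E * (g x)%:E)); last first.
  apply: eq_integral => x _; rewrite hE -ge0_mule_fsuml// => y.
  exact: nnfun_muleindic_ge0.
rewrite ge0_integral_fsum//; last 2 first.
- by move=> y; apply: emeasurable_funM => //; exact/measurable_EFinP.
- by move=> y x _; apply: mule_ge0; [exact: nnfun_muleindic_ge0|rewrite lee_fin].
apply: eq_fsbigr => r rhn; rewrite integralZl_indic_nnsfun//.
under [RHS]eq_integral do rewrite EFinM -muleA.
rewrite ge0_integralZl//.
- congr (_ * _); transitivity (\int[mu]_x ((EFin \o g) \_ (h n @^-1` [set r])) x).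
    by rewrite -integral_mkcond integral_indic// setIT.
  by apply: eq_integral => x _; rewrite epatch_indic muleC.
- by apply: emeasurable_funM; apply/measurable_EFinP.
- by move=> t _; rewrite mule_ge0 ?lee_fin.
- by move: rhn; rewrite inE => -[t _ <-]; rewrite lee_fin.
Qed.

End density_measure.

Section independent_coordinates.
Local Open Scope ereal_scope.
Context d (T : measurableType d) (R : realType) (n : nat).
Variable Q : probability (n.-tuple T) R.
Hypothesis QE : forall A : 'I_n -> set T, (forall i, measurable (A i)) ->
  Q [set t | forall i, A i (tnth t i)] =
  \prod_(i < n) Q [set t | A i (tnth t i)].

Lemma measurable_fun_tnth (h : T -> R) (i : 'I_n) :
  measurable_fun [set: T] h ->
  measurable_fun [set: n.-tuple T] (fun t => h (tnth t i)).
Proof. by move=> mh; apply: measurableT_comp => //; exact: measurable_tnth. Qed.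

Lemma measurable_prod_tnth (h : 'I_n -> T -> R) (P : pred 'I_n) :
  (forall i, measurable_fun [set: T] (h i)) ->
  measurable_fun [set: n.-tuple T] (fun t => \prod_(i | P i) h i (tnth t i))%R.
Proof.
move=> mh; under eq_fun do rewrite -big_filter.
by apply: measurable_prod => i _; exact: measurable_fun_tnth.
Qed.

Lemma measurable_tnth_preimage (A : set T) (i : 'I_n) :
  measurable A -> measurable [set t : n.-tuple T | A (tnth t i)].
Proof.
move=> mA; rewrite -[X in measurable X]setTI.
exact: (@measurable_tnth _ T n i).
Qed.

Lemma integral_indic_tnth (A : set T) (i : 'I_n) : measurable A ->
  \int[Q]_t (\1_A (tnth t i))%:E = Q [set t | A (tnth t i)].
Proof.
move=> mA.
transitivity (\int[Q]_t (\1_([set t : n.-tuple T | A (tnth t i)]) t)%:E).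
  by [].
by rewrite integral_indic ?setIT//; exact: measurable_tnth_preimage.
Qed.

(** Independence extended from events to nonnegative functions. [Q] is not given as a product
    measure, so this comes from the product rule instead of Fubini. Finite factors allow their
    product to serve as a scaling constant. *)
Lemma integral_prod_tnth (h : 'I_n -> T -> R) :
  (forall i, measurable_fun [set: T] (h i)) ->
  (forall i x, (0 <= h i x)%R) ->
  (forall i, \int[Q]_t (h i (tnth t i))%:E < +oo) ->
  \int[Q]_t (\prod_(i < n) h i (tnth t i))%R%:E =
  \prod_(i < n) \int[Q]_t (h i (tnth t i))%:E.
Proof.
move=> mh h0 hoo.
(* Indicators are replaced by general functions one coordinate at a time. *)
suff suf k : (k <= n)%N -> forall h : 'I_n -> T -> R,
    (forall i, measurable_fun [set: T] (h i)) ->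
    (forall i x, (0 <= h i x)%R) ->
    (forall i, \int[Q]_t (h i (tnth t i))%:E < +oo) ->
    (forall i : 'I_n, (k <= i)%N -> exists2 A, measurable A & h i = \1_A) ->
    \int[Q]_t (\prod_(i < n) h i (tnth t i))%R%:E =
    \prod_(i < n) \int[Q]_t (h i (tnth t i))%:E.
  by apply: (suf n) => // i; rewrite leqNgt ltn_ord.
elim: k => [_|k IH kn] {}h {}mh {}h0 {}hoo hindic.
  have /choice[A hA] : forall i, exists A, measurable A /\ h i = \1_A.
    by move=> i; have [A ? ?] := hindic i (leq0n _); exists A.
  have mA i : measurable (A i) by have [] := hA i.
  have hE i : h i = \1_(A i) by have [] := hA i.
  transitivity (Q [set t | forall i, A i (tnth t i)]).
    rewrite -[X in Q X]setIT -integral_indic//; last first.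
      rewrite (_ : [set t | _] = \bigcap_(i in [set: 'I_n]) [set t | A i (tnth t i)]).
        apply: fin_bigcap_measurable => // i _; exact: measurable_tnth_preimage.
      by apply/seteqP; split=> t /= At i; [move=> _|]; exact: At.
    apply: eq_integral => t _; congr EFin; rewrite indicE.
    under eq_bigr do rewrite hE indicE.
    case: (pselect (forall i, A i (tnth t i))) => At.
      by rewrite mem_set// big1// => i _; rewrite mem_set.
    rewrite memNset//; move/existsNP : At => [i Ai].
    by rewrite (bigD1 i)//= memNset// mul0r.
  by rewrite QE//; apply: eq_bigr => i _; rewrite hE integral_indic_tnth.
(* With the other factors frozen in the weight [w], [key] says that the measure of density [w],
   pushed to coordinate [j], is [c] times the law of that coordinate. Integrating [h j] against both
   measures frees one more coordinate from being an indicator. *)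
pose j := Ordinal kn.
pose w (t : n.-tuple T) := (\prod_(i | i != j) h i (tnth t i))%R.
have mw : measurable_fun [set: n.-tuple T] w by exact: measurable_prod_tnth.
have w0 t : (0 <= w t)%R by apply: prodr_ge0.
pose c := \prod_(i | i != j) \int[Q]_t (h i (tnth t i))%:E.
have int0 i : 0 <= \int[Q]_t (h i (tnth t i))%:E.
  by apply: integral_ge0 => t _; rewrite lee_fin.
have cfin : c \is a fin_num.
  by apply: prode_fin_num => i _; rewrite ge0_fin_numE.
have c0 : (0 <= fine c)%R by apply: fine_ge0; apply: prode_ge0.
have mtj : measurable_fun [set: n.-tuple T] (@tnth _ T ^~ j) by exact: measurable_tnth.
have key A : measurable A ->
    \int[Q]_t (\1_A (tnth t j) * w t)%:E = c * Q [set t | A (tnth t j)].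
  move=> mA; pose h' i := if i == j then \1_A : T -> R else h i.
  have h'j : h' j = \1_A by rewrite /h' eqxx.
  have h'N i : i != j -> h' i = h i by rewrite /h' => /negbTE ->.
  have IHh' : \int[Q]_t (\prod_(i < n) h' i (tnth t i))%R%:E =
      \prod_(i < n) \int[Q]_t (h' i (tnth t i))%:E.
    apply: IH; first exact: ltnW.
    - by move=> i; rewrite /h'; case: ifP.
    - by move=> i x; rewrite /h'; case: ifP => // _; rewrite indicE.
    - move=> i; rewrite /h'; case: ifP => // _.
      rewrite integral_indic_tnth// (le_lt_trans (probability_le1 _ _)) ?ltry//.
      exact: measurable_tnth_preimage.
    - move=> i; rewrite leq_eqVlt => /predU1P[ki|ki].
        by exists A => //; rewrite (_ : i = j)//; apply/val_inj.
      rewrite h'N; first exact: hindic.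
      by apply/eqP => ij; move: ki; rewrite ij ltnn.
  transitivity (\int[Q]_t (\prod_(i < n) h' i (tnth t i))%R%:E).
    apply: eq_integral => t _; rewrite (bigD1 j)//= h'j; congr (_ * _)%:E.
    by apply: eq_bigr => i ij; rewrite h'N.
  rewrite IHh' (bigD1 j)//= h'j integral_indic_tnth// muleC; congr (_ * _).
  by apply: eq_bigr => i ij; rewrite h'N.
rewrite [RHS](bigD1 j)//= -/c.
transitivity (\int[density_measure Q mw w0]_t (h j (tnth t j))%:E).
  rewrite ge0_integral_density_measure//.
  - by apply: eq_integral => t _; rewrite (bigD1 j).
  - by apply/measurable_EFinP; exact: measurable_fun_tnth.
  - by move=> t; rewrite lee_fin.
transitivity (\int[pushforward (density_measure Q mw w0) (@tnth _ T ^~ j)]_x (h j x)%:E).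
  rewrite ge0_integral_pushforward//; first exact/measurable_EFinP.
  by move=> x _; rewrite lee_fin.
transitivity (\int[pushforward (mscale (NngNum c0) Q) (@tnth _ T ^~ j)]_x (h j x)%:E).
  apply: eq_measure_integral => A mA _.
  transitivity ((fine c)%:E * Q [set t | A (tnth t j)]); last by [].
  rewrite fineK// -key//.
  transitivity (\int[Q]_(t in [set t | A (tnth t j)]) (w t)%:E); first by [].
  rewrite integral_mkcond; apply: eq_integral => t _.
  rewrite EFinM muleC.
  exact: (congr1 (fun f => f t) (epatch_indic (EFin \o w) [set t | A (tnth t j)])).
rewrite ge0_integral_pushforward//; [|exact/measurable_EFinP|]; last first.
  by move=> x _; rewrite lee_fin.
rewrite preimage_setT ge0_integral_mscale//=; last first.
- by move=> t _; rewrite lee_fin.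
- by apply/measurable_EFinP; exact: measurable_fun_tnth.
by rewrite fineK// muleC.
Qed.

End independent_coordinates.

(** * Total variation distance of product laws *)

(** Writing the identity as [X^2 + 1 = (X - 1)^2 + X + X] keeps all terms nonnegative, so integrals
    add up even when the second moment is infinite. *)
Lemma integral_sqr_sub1 d (T : measurableType d) (R : realType)
    (P : probability T R) (X : T -> R) :
  measurable_fun [set: T] X -> (forall t, 0 <= X t) ->
  (\int[P]_t (X t)%:E = 1)%E ->
  (\int[P]_t (X t ^+ 2)%:E = \int[P]_t ((X t - 1) ^+ 2)%:E + 1)%E.
Proof.
move=> mX X0 X1.
have mX2 : measurable_fun [set: T] (fun t => ((X t) ^+ 2)%:E).
  by apply/measurable_EFinP; exact: measurable_funX.
have mX12 : measurable_fun [set: T] (fun t => ((X t - 1) ^+ 2)%:E).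
  by apply/measurable_EFinP; apply: measurable_funX; exact: measurable_funB.
have : (\int[P]_t ((X t ^+ 2)%:E + 1%:E) =
        \int[P]_t (((X t - 1) ^+ 2)%:E + ((X t)%:E + (X t)%:E)))%E.
  by apply: eq_integral => t _; rewrite -!EFinD; congr EFin; ring.
rewrite ge0_integralD//=; last by move=> t _; rewrite lee_fin sqr_ge0.
rewrite [RHS]ge0_integralD//=; last 3 first.
- by move=> t _; rewrite lee_fin sqr_ge0.
- by move=> t _; rewrite lee_fin addr_ge0.
- by apply: emeasurable_funD; exact/measurable_EFinP.
rewrite ge0_integralD//=; last 4 first.
- by move=> t _; rewrite lee_fin.
- exact/measurable_EFinP.
- by move=> t _; rewrite lee_fin.
- exact/measurable_EFinP.
rewrite X1 integral_cst//= (probability_setT P) mule1 addeA.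
by move/(congr1 (fun y => y - 1)%E); rewrite !addeK.
Qed.

Section measurable_rectangles.
Context d (T : measurableType d) (n : nat).

Definition tuple_rectangles : set (set (n.-tuple T)) :=
  [set A | exists2 B : 'I_n -> set T, forall i, measurable (B i) &
    A = [set t | forall i, B i (tnth t i)]].

Lemma setI_closed_tuple_rectangles : setI_closed tuple_rectangles.
Proof.
move=> _ _ [B mB ->] [C mC ->]; exists (fun i => B i `&` C i).
  by move=> i; exact: measurableI.
apply/seteqP; split=> t /=; first by move=> [Bt Ct] i; split.
by move=> BCt; split=> i; have [] := BCt i.
Qed.

(** A generator of the tuple sigma-algebra constrains one coordinate, so it is a rectangle whose
    other sides are full; a rectangle is a finite intersection of such sets. *)
Lemma measurable_tuple_rectangles :
  measurable = <<s tuple_rectangles >>.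
Proof.
apply/seteqP; split.
  apply: smallest_sub; first exact: smallest_sigma_algebra.
  rewrite -bigcup_seq; apply: bigcup_sub => i _ _ [B mB <-].
  apply: sub_sigma_algebra; exists (fun j => if j == i then B else setT).
    by move=> j; case: ifP.
  rewrite setTI; apply/seteqP; split=> t /= Bt.
    by move=> j; case: eqP => // ->.
  by have := Bt i; rewrite eqxx.
apply: smallest_sub; first exact: sigma_algebra_measurable.
move=> _ [B mB ->].
rewrite (_ : [set t | _] =
    \bigcap_(i in [set: 'I_n]) [set t : n.-tuple T | B i (tnth t i)]).
  by apply: fin_bigcap_measurable => // i _; exact: measurable_tnth_preimage.
by apply/seteqP; split=> t /= Bt i; [move=> _|]; exact: Bt.
Qed.

End measurable_rectangles.

Section tv_dist_iid.
Local Open Scope ereal_scope.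
Context d (T : measurableType d) (R : realType) (n : nat).
Variables Q0 Q1 : probability (n.-tuple T) R.
Hypothesis Q0E : forall A : 'I_n -> set T, (forall i, measurable (A i)) ->
  Q0 [set t | forall i, A i (tnth t i)] =
  \prod_(i < n) Q0 [set t | A i (tnth t i)].
Hypothesis Q1E : forall A : 'I_n -> set T, (forall i, measurable (A i)) ->
  Q1 [set t | forall i, A i (tnth t i)] =
  \prod_(i < n) Q1 [set t | A i (tnth t i)].
Variables (l : T -> R) (v : R).
Hypotheses (ml : measurable_fun [set: T] l) (l0 : forall x, (0 <= l x)%R).
Hypothesis lE : forall (i : 'I_n) A, measurable A ->
  Q1 [set t | A (tnth t i)] = \int[Q0]_t (\1_A (tnth t i) * l (tnth t i))%:E.
Hypothesis lv : forall i : 'I_n,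
  \int[Q0]_t ((l (tnth t i) - 1) ^+ 2)%:E <= v%:E.

(** [l] is the likelihood ratio of one coordinate and [v] bounds its chi-square divergence; [L] is
    the likelihood ratio of the whole sample. *)
Let L (t : n.-tuple T) := (\prod_(i < n) l (tnth t i))%R.

Let mL : measurable_fun [set: n.-tuple T] L.
Proof. exact: (@measurable_prod_tnth _ _ _ _ (fun=> l)). Qed.

Let L0 t : (0 <= L t)%R. Proof. exact: prodr_ge0. Qed.

(** Two finite measures that agree on the pi-system of rectangles are equal; on a rectangle, the
    integral of [L] factorizes into the marginal integrals given by [lE]. *)
Let Q1_density A : measurable A -> Q1 A = \int[Q0]_(t in A) (L t)%:E.
Proof.
move=> mA; transitivity (density_measure Q0 mL L0 A); last by [].
move: A mA; apply: (measure_unique (@tuple_rectangles _ T n) (fun=> setT)).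
- exact: measurable_tuple_rectangles.
- exact: setI_closed_tuple_rectangles.
- by move=> _; exists (fun=> setT) => //; apply/seteqP; split.
- by rewrite bigcup_const//; exists 0%N.
- move=> _ [B mB ->].
  transitivity (\prod_(i < n) Q1 [set t | B i (tnth t i)]); first exact: Q1E.
  under eq_bigr do rewrite lE//.
  rewrite -(integral_prod_tnth Q0E (h := fun i x => \1_(B i) x * l x)%R).
  + rewrite /= /density_measure integral_mkcond; apply: eq_integral => t _.
    rewrite epatch_indic/= -EFinM big_split/= mulrC; congr (_ * _)%:E.
    rewrite indicE; under eq_bigr do rewrite indicE.
    case: (pselect (forall i, B i (tnth t i))) => Bt.
      by rewrite mem_set// big1// => i _; rewrite mem_set.
    rewrite memNset//; move/existsNP : Bt => [i Bi].
    by rewrite (bigD1 i)//= memNset// mul0r.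
  + by move=> i; exact: measurable_funM.
  + by move=> i x; rewrite mulr_ge0.
  + move=> i; rewrite -lE// (le_lt_trans (probability_le1 _ _)) ?ltry//.
    exact: measurable_tnth_preimage.
- by move=> _; exact: le_lt_trans (probability_le1 Q1 measurableT) (ltry _).
Qed.

Let int_L : \int[Q0]_t (L t)%:E = 1.
Proof. by rewrite -(Q1_density measurableT) (probability_setT Q1). Qed.

Let int_l i : \int[Q0]_t (l (tnth t i))%:E = 1.
Proof.
rewrite -(probability_setT Q1); have := lE i measurableT => /= ->.
by apply: eq_integral => t _; rewrite indicT mul1r.
Qed.

Let int_sqr_l i : \int[Q0]_t (l (tnth t i) ^+ 2)%:E <= (1 + v)%:E.
Proof.
rewrite (@integral_sqr_sub1 _ _ _ _ (fun t => l (tnth t i)))//.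
  by rewrite EFinD addeC leeD2l.
exact: measurable_fun_tnth.
Qed.

(** Tensorization: one plus the chi-square divergence is the second moment of the likelihood ratio,
    which is multiplicative over independent coordinates. *)
Let int_sqr_L1 : \int[Q0]_t ((L t - 1) ^+ 2)%:E <= ((1 + v) ^+ n - 1)%:E.
Proof.
rewrite EFinB leeBrDr// -integral_sqr_sub1//.
under eq_integral do rewrite /L -prodrXl.
rewrite (integral_prod_tnth Q0E (h := fun _ x => l x ^+ 2)%R).
- rewrite -[in leRHS](card_ord n) -prodr_const -prodEFin.
  suff /andP[] : 0 <= \prod_(i < n) \int[Q0]_t (l (tnth t i) ^+ 2)%:E <=
      \prod_(i < n) (1 + v)%:E by [].
  elim/big_ind2 : _ => [|x1 x2 y1 y2 /andP[? ?] /andP[? ?]|i _].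
  + by rewrite lexx lee01.
  + by rewrite mule_ge0// lee_pmul.
  + by rewrite int_sqr_l integral_ge0// => t _; rewrite lee_fin sqr_ge0.
- by move=> _; exact: measurable_funX.
- by move=> _ x; exact: sqr_ge0.
- by move=> i; rewrite (le_lt_trans (int_sqr_l i)) ?ltry.
Qed.

Let Q1_le (e : R) A : (0 < e)%R -> measurable A ->
  Q1 A <= Q0 A + (e / 2 + ((1 + v) ^+ n - 1) / (2 * e))%:E.
Proof.
move=> e0 mA; rewrite Q1_density//.
pose h t := (e / 2 + (L t - 1) ^+ 2 / (2 * e))%R.
have mh : measurable_fun [set: n.-tuple T] h.
  apply: measurable_funD => //; apply: measurable_funM => //.
  by apply: measurable_funX; exact: measurable_funB.
have h0 t : (0 <= h t)%R.
  by rewrite addr_ge0 ?divr_ge0 ?sqr_ge0 ?mulr_ge0// ltW.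
apply: (@le_trans _ _ (\int[Q0]_(t in A) (1 + (h t)%:E))).
  apply: ge0_le_integral => //.
  - by move=> t _; rewrite lee_fin.
  - exact/measurable_funTS/measurable_EFinP.
  - by apply: emeasurable_funD => //; exact/measurable_funTS/measurable_EFinP.
  (* Pointwise, [L <= 1 + e / 2 + (L - 1)^2 / (2 e)], because the gap is a perfect square divided by
     [2 e]. *)
  - move=> t _; rewrite -EFinD lee_fin -subr_ge0.
    rewrite (_ : _ - _ = (L t - 1 - e) ^+ 2 / (2 * e))%R.
      by rewrite divr_ge0 ?sqr_ge0 ?mulr_ge0 // ltW.
    by rewrite /h; field; rewrite gt_eqF.
rewrite ge0_integralD//; last 2 first.
- by move=> t _; rewrite lee_fin.
- exact/measurable_funTS/measurable_EFinP.
rewrite integral_cst// mul1e leeD2l//.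
apply: (@le_trans _ _ (\int[Q0]_t (h t)%:E)).
  by apply: ge0_subset_integral => //; [exact/measurable_EFinP|
    move=> t _; rewrite lee_fin].
under eq_integral do rewrite EFinD.
rewrite ge0_integralD//=; last 3 first.
- by move=> t _; rewrite lee_fin divr_ge0// ltW.
- by move=> t _; rewrite lee_fin divr_ge0 ?sqr_ge0 ?mulr_ge0// ltW.
- apply/measurable_EFinP; apply: measurable_funM => //.
  by apply: measurable_funX; exact: measurable_funB.
rewrite integral_cst// [X in _ * X](_ : _ = 1); last exact: probability_setT.
rewrite mule1 EFinD leeD2l//.
under eq_integral do rewrite mulrC EFinM.
rewrite ge0_integralZl//=; last 3 first.
- by apply/measurable_EFinP; apply: measurable_funX; exact: measurable_funB.
- by move=> t _; rewrite lee_fin sqr_ge0.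
- by rewrite lee_fin invr_ge0 mulr_ge0// ltW.
by rewrite [in leRHS]mulrC EFinM lee_wpmul2l// lee_fin invr_ge0 mulr_ge0// ltW.
Qed.

Lemma tv_dist_iid_le (e : R) : (0 < e)%R ->
  tv_dist Q0 Q1 <= (e / 2 + ((1 + v) ^+ n - 1) / (2 * e))%:E.
Proof.
move=> e0; apply: ge_ereal_sup => _ [A mA <-].
(* The one-sided bound applied to the complement of [A] is the reverse inequality for [A], since
   both laws have mass one. *)
have := Q1_le e0 mA; have := Q1_le e0 (measurableC mA).
rewrite !probability_setC//.
rewrite -(fineK (fin_num_measure Q0 A mA)) -(fineK (fin_num_measure Q1 A mA)).
rewrite -!EFinB -!EFinD !lee_fin ler_norml.
set K := (e / 2 + _)%R.
by move=> H1 H2; apply/andP; split; lra.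
Qed.

End tv_dist_iid.

(** * Lebesgue measure on the real line *)

(** Left half-lines are stable under intersection, generate the Borel sets and exhaust the line.
    This is how a distribution function determines a marginal law. *)
Lemma measure_eq_on_halflines (R : realType)
    (m1 m2 : {measure set (measurableTypeR R) -> \bar R}) :
  (m1 setT < +oo)%E -> (forall x : R, m1 `]-oo, x]%classic = m2 `]-oo, x]%classic) ->
  forall A, measurable A -> m1 A = m2 A.
Proof.
move=> m1oo m12.
apply: (@measure_unique _ R (measurableTypeR R)
  [set A | exists x : R, A = `]-oo, x]%classic] (fun n => `]-oo, n%:R]%classic)).
- apply/seteqP; split; last first.
    apply: smallest_sub; first exact: sigma_algebra_measurable.
    by move=> _ [x ->]; exact: measurable_itv.
  move=> A; rewrite [X in X A](RGenOInfty.measurableE R); move: A.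
  apply: smallest_sub; first exact: smallest_sigma_algebra.
  move=> _ [x ->]; rewrite -setCitvl; apply: sigma_algebraC.
  by apply: sub_sigma_algebra; exists x.
- move=> _ _ [x ->] [y ->]; exists (Num.min x y).
  by apply/seteqP; split=> z /=; rewrite !in_itv/= le_min; [move=> [-> ->]|move/andP].
- by move=> n; exists n%:R.
- apply/seteqP; split=> // x _; exists (Num.bound `|x|) => //=.
  by rewrite in_itv/= (le_trans (ler_norm _))// ltW// archi_boundP.
- by move=> _ [x ->].
- move=> n; apply: le_lt_trans m1oo; apply: le_measure => //; rewrite inE//.
Qed.

Section lebesgue_translation.
Context {R : realType}.
Local Notation mu := (@lebesgue_measure R).

Lemma measurable_shift (a : R) :
  measurable_fun [set: measurableTypeR R]
    ((fun x : R => x - a) : measurableTypeR R -> measurableTypeR R).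
Proof. exact: (@measurable_funB _ R R). Qed.

Lemma lebesgue_measure_shift (a : R) A : measurable A ->
  pushforward mu ((fun x => x - a) : _ -> measurableTypeR R) A = mu A.
Proof.
have ms := measurable_shift a.
move=> mA; apply/esym/lebesgue_measure_unique => //= _ [[u v]] _ <-.
rewrite /pushforward/= (_ : _ @^-1` _ = `]u + a, v + a]%classic); last first.
  by apply/seteqP; split=> x /=; rewrite !in_itv/= ltrBrDr lerBlDr.
rewrite !lebesgue_measure_itv/= !lte_fin ltrD2r; case: ifPn => // _.
by rewrite -!EFinD; congr EFin; ring.
Qed.

Lemma ge0_integral_shift (a : R) (D : set R) (f : R -> \bar R) :
  measurable D -> measurable_fun [set: R] f -> (forall x, 0 <= f x)%E ->
  (\int[mu]_(x in (fun x => (x - a)%R) @^-1` D) f (x - a)%R = \int[mu]_(x in D) f x)%E.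
Proof.
move=> mD mf f0; have ms := measurable_shift a.
rewrite -[LHS](@ge0_integral_pushforward _ _ _ _ R _ ms mu D f)//; last exact: measurable_funTS.
by apply: eq_measure_integral => A mA _; exact: lebesgue_measure_shift.
Qed.

End lebesgue_translation.

Lemma ge0_integral_symmetric (R : realType) (f : R -> R) :
  measurable_fun [set: R] f -> (forall x, 0 <= f x) -> (forall x, f (- x) = f x) ->
  (\int[lebesgue_measure]_x (f x)%:E =
   \int[lebesgue_measure]_(x in `]0%R, +oo[) (f x)%:E +
   \int[lebesgue_measure]_(x in `]0%R, +oo[) (f x)%:E)%E.
Proof.
move=> mf f0 fN.
have mfE : measurable_fun [set: R] (EFin \o f) by exact/measurable_EFinP.
have f0E x : (0 <= (f x)%:E)%E by rewrite lee_fin.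
have -> : [set: R] = `]-oo, 0] `|` `]0, +oo[.
  apply/seteqP; split=> // x _ /=; rewrite !in_itv/= andbT.
  by case: leP; [left|right].
rewrite ge0_integral_setU//=.
- congr (_ + _)%E; rewrite integral_itv_obnd_cbnd; last exact: measurable_funTS.
  by rewrite ge0_integration_by_substitution0//; apply: eq_integral => x _; rewrite fN.
- exact: measurable_funTS.
- apply/disj_setPS => x /= []; rewrite !in_itv/= andbT => x0 /(le_lt_trans x0).
  by rewrite ltxx.
Qed.

(** The integrand may blow up at 0 and the domain is unbounded, so the fundamental theorem of
    calculus is applied on the compact intervals [E n] increasing to the half-line; the bound on [F]
    passes to the limit. *)
Lemma integral_le_bounded_primitive (R : realType) (F f : R -> R) (B : R) :
  (forall x : R, 0 < x -> is_derive x 1 F (f x)) ->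
  (forall x : R, 0 < x -> {for x, continuous f}) ->
  measurable_fun [set: R] f ->
  (forall x : R, 0 < x -> 0 <= f x) -> (forall x : R, 0 < x -> `|F x| <= B) ->
  (\int[lebesgue_measure]_(x in `]0%R, +oo[) (f x)%:E <= (B + B)%:E)%E.
Proof.
move=> dF cf mf f0 FB; pose E n := `[(n.+1%:R : R)^-1, n.+1%:R]%classic.
have -> : `]0%R, +oo[%classic = \bigcup_n E n.
  apply/seteqP; split=> x /=; rewrite in_itv/= andbT.
    move=> x0; exists (maxn (Num.bound x) (Num.bound x^-1)) => //=.
    rewrite /E/= in_itv/= -[leRHS]invrK lef_pV2 ?posrE ?ltr0n ?invr_gt0//.
    have le k m : (k <= m)%N -> k%:R <= m.+1%:R :> R.
      by move=> km; rewrite ler_nat (leq_trans km).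
    apply/andP; split.
    - by rewrite (le_trans (ltW (archi_boundP _)) (le _ _ (leq_maxr _ _)))// invr_ge0 ltW.
    - by rewrite (le_trans (ltW (archi_boundP (ltW x0))) (le _ _ (leq_maxl _ _))).
  by move=> [n _]; rewrite /E/= in_itv/= => /andP[+ _]; apply: lt_le_trans; rewrite invr_gt0.
have E0 n x : E n x -> 0 < x.
  by rewrite /E/= in_itv/= => /andP[+ _]; apply: lt_le_trans; rewrite invr_gt0.
have mE n : measurable (E n) by exact: measurable_itv.
have ndE : nondecreasing_seq E.
  move=> m n mn; apply/subsetPset => x; rewrite /E/= !in_itv/= => /andP[xm xn].
  rewrite (le_trans _ xm) ?(le_trans xn) ?ler_nat//.
  by rewrite lef_pV2 ?posrE ?ltr0n// ler_nat.
have mfE n : measurable_fun (E n) (EFin \o f).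
  by apply: measurable_funTS; exact/measurable_EFinP.
have fE0 n x : E n x -> (0 <= (EFin \o f) x)%E.
  by move=> /E0 x0; rewrite lee_fin f0.
have cvgE := ge0_nondecreasing_set_cvg_integral (mu := lebesgue_measure) ndE mE mfE fE0.
have /cvg_lim <- // := cvgE; apply: lime_le; first by apply/cvg_ex; eexists; exact: cvgE.
apply: nearW => n.
(* For [n = 0] the interval is the single point 1, whereas the fundamental theorem asks for distinct
   endpoints. *)
have [->|n0] := eqVneq n 0%N.
  rewrite /E invr1 set_itv1 integral_set1 lee_fin addr_ge0//;
    by apply: le_trans (FB 1 ltr01).
have ab : (n.+1%:R : R)^-1 < n.+1%:R.
  by rewrite (@lt_trans _ _ 1)// ?invf_lt1 ?ltr0n// ltr1n ltnS lt0n.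
have a0 : 0 < (n.+1%:R : R)^-1 by rewrite invr_gt0.
have cF x : 0 < x -> {for x, continuous F}.
  by move=> x0; apply: differentiable_continuous; apply/derivable1_diffP; have [] := dF x x0.
rewrite (@continuous_FTC2 _ f F)//.
- rewrite -EFinB lee_fin (le_trans (ler_norm _))// (le_trans (ler_normB _ _))// lerD//.
    by apply: FB; exact: lt_trans ab.
  exact: FB.
- apply: continuous_in_subspaceT => x; rewrite inE/= in_itv/= => /andP[ax _].
  by apply: cf; exact: lt_le_trans ax.
- split.
  + move=> x; rewrite in_itv/= => /andP[ax _].
    by have [] := dF x (lt_trans a0 ax).
  + by apply: cvg_at_right_filter; exact: cF.
  + by apply: cvg_at_left_filter; apply: cF; exact: lt_trans ab.
- move=> x; rewrite in_itv/= => /andP[ax _].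
  by rewrite derive1E; have [_ ->] := dF x (lt_trans a0 ax).
Qed.

(** Raise [y / k <= expR (y / k)] to the power [k]. *)
Lemma powR_le_expR (R : realType) (k y : R) : 0 < k -> 0 <= y ->
  y `^ k <= k `^ k * expR y.
Proof.
move=> k0 y0; have yk0 : 0 <= y / k by rewrite divr_ge0// ltW.
rewrite -[y in leLHS](@divfK _ k) ?gt_eqF// mulrC powRM//; last exact: ltW.
rewrite ler_pM2l ?powR_gt0// -[y in leRHS](@divfK _ k) ?gt_eqF// expRM.
rewrite ge0_ler_powR ?nnegrE ?expR_ge0//; first exact: ltW.
by rewrite (le_trans _ (expR_ge1Dx _))// lerDr.
Qed.

Lemma sqr_powR_le_expR (R : realType) (r c g : R) : 0 < r -> 0 < c -> 0 < g ->
  exists2 K : R, 0 < K & forall x : R, 0 < x ->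
    (1 + x `^ r) ^+ 2 <= K * expR (c * x `^ g).
Proof.
(* With this [k], [(c x^g)^k = c^k (x^r)^2], so the previous lemma bounds the square of [x^r]. *)
move=> r0 c0 g0; pose k := 2 * r / g.
have k0 : 0 < k by rewrite divr_gt0// mulr_gt0.
have ck0 : 0 < c `^ k by rewrite powR_gt0.
exists (2 * (1 + k `^ k / c `^ k)).
  by rewrite mulr_gt0// addr_gt0// divr_gt0// powR_gt0.
move=> x x0; have xg0 : 0 <= c * x `^ g by rewrite mulr_ge0 ?powR_ge0// ltW.
have e1 : 1 <= expR (c * x `^ g).
  by rewrite (le_trans _ (expR_ge1Dx _))// lerDl.
have xE : (c * x `^ g) `^ k = c `^ k * (x `^ r) ^+ 2.
  rewrite powRM ?powR_ge0//; last exact: ltW.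
  have gk : g * k = r * 2%:R by rewrite /k; field; rewrite gt_eqF.
  by rewrite -powRrM gk powRrM powR_mulrn ?powR_ge0.
have := powR_le_expR k0 xg0; rewrite xE mulrC -ler_pdivlMr// => xr.
have : (1 + x `^ r) ^+ 2 <= 2 * (1 + (x `^ r) ^+ 2).
  by rewrite -subr_ge0 (_ : _ - _ = (1 - x `^ r) ^+ 2) ?sqr_ge0//; ring.
move/le_trans; apply; rewrite -mulrA ler_pM2l// mulrDl mul1r lerD//.
by rewrite mulrAC.
Qed.

Lemma measurable_norm_powR (R : realType) (a : R) :
  measurable_fun [set: R] (fun x => `|x| `^ a).
Proof. exact: (measurableT_comp (@measurable_powR R a)). Qed.

Lemma measurable_powR_expR (R : realType) (q c g : R) :
  measurable_fun [set: R] (fun x => `|x| `^ q * expR (- (c * `|x| `^ g))).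
Proof.
apply: measurable_funM; first exact: measurable_norm_powR.
apply: measurableT_comp => //; apply: measurableT_comp => //.
by apply: measurable_funM => //; exact: measurable_norm_powR.
Qed.

(** By symmetry it is enough to work on the positive half-line. There the integrand is dominated by
    a multiple of [r x^(r - 1) / (1 + x^r)^2] with [r = q + 1]: it has the same behaviour [x^q] at
    0, and its primitive [- 1 / (1 + x^r)] is bounded by 1. The exponential absorbs the
    denominator. *)
Lemma integral_powR_expR_lty (R : realType) (q c g : R) :
  -1 < q -> 0 < c -> 0 < g ->
  (\int[lebesgue_measure]_x (`|x| `^ q * expR (- (c * `|x| `^ g)))%:E < +oo)%E.
Proof.
move=> q1 c0 g0; pose r := q + 1.
have r0 : 0 < r by rewrite /r -ltrBlDr sub0r.
have [K K0 HK] := sqr_powR_le_expR r0 c0 g0.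
pose F (x : R) := - (1 + x `^ r) `^ (-1).
pose f (x : R) := r * x `^ (r - 1) * (1 + x `^ r) `^ (-2).
have pos (x : R) : 0 < 1 + x `^ r by rewrite ltr_wpDr ?powR_ge0.
have dF (x : R) : 0 < x -> is_derive x 1 F (f x).
  move=> x0; have dx := is_derive1_powR r x0.
  have d1 := is_derive1_powR (-1) (pos x).
  have dy : is_derive x 1 (fun y => 1 + y `^ r) (0 + r * x `^ (r - 1)).
    exact: is_deriveD.
  have dc := is_derive1_comp (f := (@powR R) ^~ (-1)) (g := fun y => 1 + y `^ r) d1 dy.
  apply: (is_derive_eq (is_deriveN dc)); rewrite /f.
  by rewrite (_ : -1 - 1 = -2 :> R); ring.
have cp (a x : R) : 0 < x -> {for x, continuous (@powR R ^~ a)}.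
  move=> x0; apply: differentiable_continuous; apply/derivable1_diffP.
  by have [] := is_derive1_powR a x0.
have cf (x : R) : 0 < x -> {for x, continuous f}.
  move=> x0; apply: cvgM; first by apply: cvgM; [exact: cvg_cst|exact: cp].
  apply: (@continuous_comp _ _ _ (fun y : R => 1 + y `^ r) ((@powR R) ^~ (-2))); last exact: cp.
  by apply: cvgD; [exact: cvg_cst|exact: cp].
have mf : measurable_fun [set: R] f.
  apply: measurable_funM.
    by apply: measurable_funM => //; exact: measurable_powR.
  by apply: (measurableT_comp (@measurable_powR R (-2))); exact: measurable_funD.
have f0 (x : R) : 0 <= f x by rewrite !mulr_ge0 ?powR_ge0// ltW.
have FB (x : R) : 0 < x -> `|F x| <= 1.
  move=> x0; rewrite normrN ger0_norm ?powR_ge0//.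
  by rewrite powR_inv1 ?(ltW (pos _))// invf_le1// lerDl powR_ge0.
have If := integral_le_bounded_primitive dF cf mf (fun x _ => f0 x) FB.
have mh := measurable_powR_expR q c g.
rewrite ge0_integral_symmetric//; last by move=> x; rewrite normrN.
suff : (\int[lebesgue_measure]_(x in `]0%R, +oo[)
    (`|x| `^ q * expR (- (c * `|x| `^ g)))%:E < +oo)%E.
  by move=> h; exact: lte_add_pinfty.
apply: (@le_lt_trans _ _
    (\int[lebesgue_measure]_(x in `]0%R, +oo[) ((K / r)%:E * (f x)%:E))%E).
  apply: ge0_le_integral => //.

  - by apply: measurable_funTS; exact/measurable_EFinP.
  - by apply: measurable_funTS; apply: measurable_funeM; exact/measurable_EFinP.
  - move=> x /=; rewrite in_itv/= andbT => x0; rewrite -EFinM lee_fin gtr0_norm// /f.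
    rewrite mulrA mulrA divfK ?gt_eqF// (_ : r - 1 = q); last by rewrite /r addrK.
    rewrite [K * _]mulrC -mulrA ler_wpM2l ?powR_ge0//.
    rewrite powR_invn ?(ltW (pos x))//.
    rewrite ler_pdivlMr ?exprn_gt0// expRN mulrC ler_pdivrMr ?expR_gt0//.
    exact: HK.
rewrite ge0_integralZl//.
- apply: (@le_lt_trans _ _ ((K / r)%:E * (1 + 1)%:E)%E); last by rewrite -EFinM ltry.
  by rewrite lee_wpmul2l// lee_fin divr_ge0// ltW.
- exact/measurable_funTS/measurable_EFinP.
- by move=> x _; rewrite lee_fin.
- by rewrite lee_fin divr_ge0// ltW.
Qed.

(** * The chi-square divergence of a shifted generalized Gaussian *)

(** A form of Bernoulli's inequality; the gap at the induction step is [(1 - t) (1 - t^N)]. *)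
Lemma onem_exprn_le (R : realType) (t : R) (N : nat) : 0 <= t <= 1 ->
  1 - t ^+ N <= N%:R * (1 - t).
Proof.
move=> /andP[t0 t1]; elim: N => [|N IH]; first by rewrite expr0 subrr mul0r.
have tN : t ^+ N <= 1 by rewrite exprn_ile1.
rewrite exprSr -natr1 mulrDl mul1r; apply: le_trans (lerD IH (lexx _)).
rewrite -subr_ge0 (_ : _ - _ = (1 - t) * (1 - t ^+ N)); last by ring.
by rewrite mulr_ge0 ?subr_ge0.
Qed.

(** By homogeneity only [t = b / a] matters, and then [1 - t^g <= 1 - t^N <= N (1 - t) <= N (1 -
    t)^p]. Rounding [g] up to an integer [N] makes the middle step Bernoulli; the last step uses
    [p <= 1]. *)
Lemma sub_powR_le (R : realType) (g p a b : R) (N : nat) :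
  g <= N%:R -> (0 < N)%N -> 0 < g -> 0 < p <= 1 -> 0 < a -> 0 <= b <= a ->
  a `^ g - b `^ g <= N%:R * a `^ (g - p) * (a - b) `^ p.
Proof.
move=> gN N0 g0 /andP[p0 p1] a0 /andP[b0 ba]; pose t := b / a.
have t0 : 0 <= t by rewrite divr_ge0// ltW.
have t1 : t <= 1 by rewrite ler_pdivrMr// mul1r.
have bE : b = a * t by rewrite /t mulrC divfK ?gt_eqF.
have agp : a `^ (g - p) * a `^ p = a `^ g.
  by rewrite -powRD ?subrK// gt_eqF ?implybT.
rewrite (_ : a - b = a * (1 - t)); last by rewrite bE; ring.
rewrite powRM ?subr_ge0 ?(ltW a0)// -mulrA (mulrA (a `^ (g - p))) agp.
rewrite bE powRM ?(ltW a0)// mulrCA -[X in X - _]mulr1 -mulrBr ler_pM2l ?powR_gt0//.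
have onem_t : 1 - t <= (1 - t) `^ p.
  have [->|t_neq1] := eqVneq (1 - t) 0; first exact: powR_ge0.
  by rewrite ger1_powR// lt_neqAle eq_sym t_neq1 subr_ge0 t1 lerBlDr lerDl.
apply: (@le_trans _ _ (N%:R * (1 - t))); last by rewrite ler_wpM2l.
apply: le_trans (onem_exprn_le N _); last by rewrite t0.
rewrite lerD2l lerN2 -powR_mulrn//.
have [->|t_neq0] := eqVneq t 0; first by rewrite !powR0 ?gt_eqF ?ltr0n.
by rewrite ger_powR// lt_neqAle eq_sym t_neq0 t0.
Qed.

Lemma dist_powR_norm_le (R : realType) (g p x y : R) (N : nat) :
  g <= N%:R -> (0 < N)%N -> 0 < g -> 0 < p <= 1 -> x != 0 ->
  `| `|x| `^ g - `|y| `^ g| <=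
    N%:R * Num.max `|x| `|y| `^ (g - p) * `|x - y| `^ p.
Proof.
move=> gN N0 g0 p01 x0; have p0 : 0 <= p by case/andP: p01 => /ltW.
have xp : 0 < `|x| by rewrite normr_gt0.
have [yx|/ltW xy] := leP `|y| `|x|.
  rewrite ger0_norm ?subr_ge0 ?ge0_ler_powR ?nnegrE ?(ltW g0)//.
  apply: (le_trans (sub_powR_le gN N0 g0 p01 xp _)); first by rewrite normr_ge0.
  rewrite ler_wpM2l ?mulr_ge0 ?powR_ge0// ge0_ler_powR ?nnegrE ?subr_ge0//.
  exact: lerB_dist.
rewrite distrC ger0_norm ?subr_ge0 ?ge0_ler_powR ?nnegrE ?(ltW g0)//.
have yp : 0 < `|y| by exact: lt_le_trans xy.
apply: (le_trans (sub_powR_le gN N0 g0 p01 yp _)); first by rewrite normr_ge0.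
rewrite ler_wpM2l ?mulr_ge0 ?powR_ge0// ge0_ler_powR ?nnegrE ?subr_ge0//.
by rewrite distrC lerB_dist.
Qed.

(** Eliminates the shifted point [b]. For [q >= 0] the maximum is at most [2 max(a, 1)]; for [q < 0]
    it is at least [a], so its power is at most [a^q] and [b] close to 0 does no harm. *)
Lemma powR_max_le (R : realType) (q a b : R) : 0 < a -> 0 <= b <= a + 1 ->
  Num.max a b `^ q <= (2 `^ q + 1) * (a `^ q + 1).
Proof.
move=> a0 /andP[b0 ba1]; have q2 : 0 <= 2 `^ q :> R by exact: powR_ge0.
have aq : 0 <= a `^ q by exact: powR_ge0.
have am : a <= Num.max a b by rewrite le_max lexx.
have mp : 0 < Num.max a b by exact: lt_le_trans am.
have [q0|/ltW q0] := leP 0 q.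
  apply: (@le_trans _ _ (2 `^ q * (Num.max a 1) `^ q)).
    rewrite -powRM ?le_max ?(ltW a0)// ge0_ler_powR ?nnegrE ?(ltW mp)//.
      by rewrite mulr_ge0// le_max ltW.
    by case: (leP a b) => ?; case: (leP a 1) => ?; lra.
  rewrite ler_pM ?powR_ge0// ?lerDl//.
  by case: (leP a 1) => _; rewrite ?powR1 ?lerDr ?lerDl.
apply: (@le_trans _ _ (a `^ q)).
  rewrite -(opprK q) !(powRN _ (- q)) lef_pV2 ?posrE ?powR_gt0//.
  by rewrite ge0_ler_powR ?nnegrE ?(ltW a0) ?(ltW mp)// oppr_ge0.
by nra.
Qed.

(** The ratio [lam] is chosen with [lam^g = 3/4]. Either [b >= lam a], and [2 b^g] suffices by
    itself, or [(1 - lam) a < 1], and [a] is bounded, which gives [K]. *)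
Lemma powR_add1_le (R : realType) (g : R) : 0 < g ->
  exists K : R, forall a b : R, 0 <= a <= b + 1 -> 0 <= b ->
    3 / 2 * a `^ g <= K + 2 * b `^ g.
Proof.
move=> g0; pose lam : R := (3 / 4) `^ g^-1.
have lamg : lam `^ g = 3 / 4.
  by rewrite /lam -powRrM mulVf ?gt_eqF// powRr1//; lra.
have lam0 : 0 < lam by rewrite powR_gt0; lra.
have lam1 : lam < 1.
  rewrite ltNge; apply/negP => lam1.
  have := @ge0_ler_powR _ g (ltW g0) 1 lam; rewrite !nnegrE ler01 (ltW lam0).
  by move=> /(_ isT isT lam1); rewrite lamg powR1; lra.
exists (3 / 2 * (1 - lam)^-1 `^ g) => a b /andP[a0 ab] b0.
have [lab|bla] := leP (lam * a) b.
  apply: (@le_trans _ _ (2 * (lam * a) `^ g)).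
    by rewrite powRM ?(ltW lam0)// lamg; lra.
  apply: (@le_trans _ _ (2 * b `^ g)); last by rewrite lerDr mulr_ge0 ?powR_ge0//; lra.
  by rewrite ler_pM2l// ge0_ler_powR ?nnegrE ?(ltW g0)// mulr_ge0// ltW.
apply: (@le_trans _ _ (3 / 2 * (1 - lam)^-1 `^ g)); last first.
  by rewrite lerDl mulr_ge0 ?powR_ge0.
rewrite ler_pM2l; last by lra.
rewrite ge0_ler_powR ?nnegrE ?(ltW g0) ?invr_ge0 ?subr_ge0 ?(ltW lam1)//.
by rewrite -[leRHS]mul1r ler_pdivlMr ?subr_gt0//; lra.
Qed.

(** For [u >= 0], [expR u - 1 <= u * expR u]; for [u <= 0], [1 - expR u <= - u]. The two summands on
    the right cover the two signs. *)
Lemma sqr_expRB1_le (R : realType) (u : R) :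
  (expR u - 1) ^+ 2 <= u ^+ 2 * (1 + expR (u *+ 2)).
Proof.
have e2 : expR (u *+ 2) = expR u ^+ 2 by rewrite mulr2n expRD expr2.
have [u0|/ltW u0] := leP 0 u.
  have h : 0 <= expR u - 1 <= u * expR u.
    rewrite subr_ge0 (le_trans _ (expR_ge1Dx _)) ?lerDl//=.
    have := expR_ge1Dx (- u); rewrite expRN => h.
    have := ler_wpM2r (expR_ge0 u) h; rewrite mulVf ?gt_eqF ?expR_gt0//; lra.
  apply: (@le_trans _ _ ((u * expR u) ^+ 2)).
    by case/andP: h => h0 h1; rewrite lerXn2r// nnegrE// (le_trans h0).
  by rewrite e2 exprMn ler_wpM2l ?sqr_ge0// lerDr.
have h : 0 <= 1 - expR u <= - u.
  by have := expR_ge1Dx u; have := expR_le1 u; rewrite u0 => ?; lra.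
rewrite -sqrrN opprB; apply: (@le_trans _ _ ((- u) ^+ 2)).
  by case/andP: h => h0 h1; rewrite lerXn2r// nnegrE// (le_trans h0).
by rewrite sqrrN ler_peMr ?sqr_ge0// lerDl expR_ge0.
Qed.

Lemma gen_gauss_chi2_pointwise (R : realType) (g p : R) : 0 < g -> 0 < p <= 1 ->
  exists2 C : R, 0 <= C & forall m x : R, 0 < m <= 1 -> x != 0 ->
    (gen_gauss_fun g (x - m) / gen_gauss_fun g x - 1) ^+ 2 * gen_gauss_fun g x <=
    C * m `^ (2 * p) *
      ((`|x| `^ (2 * (g - p)) + 1) * expR (- ((2 * g)^-1 * `|x| `^ g))).
Proof.
move=> g0 p01; have p0 : 0 < p by case/andP: p01.
pose N := Num.bound g; have gN : g < N%:R by rewrite archi_boundP// ltW.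
have N0 : (0 < N)%N by rewrite -(ltr0n R) (lt_trans g0).
have [K HK] := powR_add1_le g0.
pose C1 := 2 `^ (2 * (g - p)) + 1 : R.
pose C2 := 1 + expR (K / g).
have C20 : 0 <= C2 by rewrite addr_ge0 ?expR_ge0.
have C10 : 0 <= C1 by rewrite addr_ge0 ?powR_ge0.
exists ((N%:R / g) ^+ 2 * C1 * C2).
  by do 2!rewrite mulr_ge0 //; exact: sqr_ge0.
move=> m x /andP[m0 m1] x0; pose y := x - m.
(* [u] is the logarithm of the ratio of the shifted density to the original one. *)
pose u := (`|x| `^ g - `|y| `^ g) / g.
have sqrP a r : (a `^ r) ^+ 2 = a `^ (2 * r) :> R.
  by rewrite -powR_mulrn ?powR_ge0// -powRrM mulrC.
have yx : `|y| <= `|x| + 1.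
  by rewrite (le_trans (ler_normB _ _))// lerD2l gtr0_norm.
have xy : `|x| <= `|y| + 1.
  rewrite -[x in leLHS](subrK m) (le_trans (ler_normD _ _))// lerD2l gtr0_norm//.
have u2 : u ^+ 2 <= (N%:R / g) ^+ 2 * (C1 * (`|x| `^ (2 * (g - p)) + 1)) * m `^ (2 * p).
  have := dist_powR_norm_le y (ltW gN) N0 g0 p01 x0.
  rewrite (_ : x - y = m); last by rewrite /y; ring.
  rewrite (gtr0_norm m0) => hu.
  have hu2 : (`|x| `^ g - `|y| `^ g) ^+ 2 <=
      (N%:R * Num.max `|x| `|y| `^ (g - p) * m `^ p) ^+ 2.
    by rewrite -real_normK ?num_real// lerXn2r// nnegrE (le_trans _ hu).
  rewrite /u expr_div_n ler_pdivrMr ?exprn_gt0//; apply: (le_trans hu2).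
  rewrite 2!exprMn !sqrP expr_div_n.
  have M := @powR_max_le _ (2 * (g - p)) `|x| `|y|.
  have {}M := M (ltac:(by rewrite normr_gt0)) (ltac:(by rewrite normr_ge0)).
  rewrite (_ : _ * m `^ (2 * p) * g ^+ 2 =
    N%:R ^+ 2 * (C1 * (`|x| `^ (2 * (g - p)) + 1)) * m `^ (2 * p)); last first.
    by field; rewrite gt_eqF.
  by rewrite ler_wpM2r ?powR_ge0// ler_wpM2l ?sqr_ge0.
have fE : gen_gauss_fun g y / gen_gauss_fun g x = expR u.
  by rewrite /gen_gauss_fun -expRB /u; congr expR; rewrite mulrBl; ring.
rewrite fE; apply: (@le_trans _ _ (u ^+ 2 * (1 + expR (u *+ 2)) * gen_gauss_fun g x)).
  by rewrite ler_wpM2r ?expR_ge0 ?sqr_expRB1_le.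
have xg : 0 <= `|x| `^ g by exact: powR_ge0.
pose e := expR (- ((2 * g)^-1 * `|x| `^ g)).
(* The product of [expR (u *+ 2)] and the density has exponent [(|x|^g - 2 |y|^g) / g]. By [HK] this
   is at most [K / g - |x|^g / (2 g)]: half of the original decay survives, uniformly in [m]. *)
have h2 : (1 + expR (u *+ 2)) * gen_gauss_fun g x <= C2 * e.
  rewrite /C2 !mulrDl !mul1r -!expRD lerD// ler_expR.
    rewrite lerN2 mulrC ler_wpM2l// lef_pV2 ?posrE ?mulr_gt0//.
    by rewrite ler_peMl ?(ltW g0)// ler1n.
  have := HK `|x| `|y|; rewrite normr_ge0 xy => /(_ isT (normr_ge0 _)) h.
  rewrite /u -subr_ge0.
  rewrite (_ : _ - _ = (K + 2 * `|y| `^ g - 3 / 2 * `|x| `^ g) / g).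
    by rewrite divr_ge0 ?(ltW g0)// subr_ge0.
  by field; rewrite gt_eqF.
rewrite -mulrA; apply: (le_trans (ler_wpM2l (sqr_ge0 _) h2)).
apply: (le_trans (ler_wpM2r _ u2)); first by rewrite mulr_ge0 ?expR_ge0.
by rewrite /e le_eqVlt; apply/orP; left; apply/eqP; ring.
Qed.

Lemma measurable_gen_gauss_fun (R : realType) (g : R) :
  measurable_fun [set: R] (gen_gauss_fun g).
Proof.
apply: measurableT_comp => //; apply: measurableT_comp => //.
by apply: measurable_funM => //; exact: measurable_norm_powR.
Qed.

Lemma measurable_gen_gauss_ratio (R : realType) (g m : R) :
  measurable_fun [set: R] (fun x => gen_gauss_fun g (x - m) / gen_gauss_fun g x).
Proof.
have mg := measurable_gen_gauss_fun g; apply: measurable_funM.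
  by apply: (measurableT_comp mg); exact: measurable_funB.
under eq_fun do rewrite /gen_gauss_fun -expRN.
apply: measurableT_comp => //; do 2 apply: measurableT_comp => //.
by apply: measurable_funM => //; exact: measurable_norm_powR.
Qed.

Lemma integral_gen_gauss_chi2 (R : realType) (g p : R) : 0 < g -> 0 < p <= 1 ->
    p < 1 / 2 + g ->
  exists2 C : R, 0 <= C & forall m : R, 0 < m <= 1 ->
  (\int[lebesgue_measure]_x ((gen_gauss_fun g (x - m) / gen_gauss_fun g x - 1) ^+ 2 *
     gen_gauss_fun g x)%:E <= (C * m `^ (2 * p))%:E)%E.
Proof.
move=> g0 p01 pg; have p0 : 0 < p by case/andP: p01.
have [C C0 HC] := gen_gauss_chi2_pointwise g0 p01.
pose D q (x : R) := `|x| `^ q * expR (- ((2 * g)^-1 * `|x| `^ g)).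
have mD q : measurable_fun [set: R] (D q) by exact: measurable_powR_expR.
have mDE q : measurable_fun [set: R] (fun x => (D q x)%:E) by exact/measurable_EFinP.
have D0 q x : (0 <= (D q x)%:E)%E by rewrite lee_fin mulr_ge0 ?powR_ge0 ?expR_ge0.
have Doo q : -1 < q -> (\int[lebesgue_measure]_x (D q x)%:E)%E \is a fin_num.
  move=> q1; rewrite ge0_fin_numE; last exact: integral_ge0.
  by apply: integral_powR_expR_lty => //; rewrite invr_gt0 mulr_gt0.
(* This is where [p < 1/2 + g] enters: it says that [2 (g - p) > -1]. *)
have D1oo := Doo (2 * (g - p)) ltac:(lra).
have D2oo := Doo 0 ltac:(lra).
pose I q := fine (\int[lebesgue_measure]_x (D q x)%:E)%E.
have I0 q : 0 <= I q by apply: fine_ge0; exact: integral_ge0.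
exists (C * (I (2 * (g - p)) + I 0)).
  by rewrite mulr_ge0 ?addr_ge0.
move=> m m01; have m2 : 0 <= m `^ (2 * p) by exact: powR_ge0.
have mg : measurable_fun [set: R] (gen_gauss_fun g) by exact: measurable_gen_gauss_fun.
apply: (@le_trans _ _ (\int[lebesgue_measure]_x
   ((C * m `^ (2 * p))%:E * ((D (2 * (g - p)) x)%:E + (D 0 x)%:E)))%E).
  apply: ae_ge0_le_integral => //.
  - by move=> x _; rewrite lee_fin mulr_ge0 ?sqr_ge0 ?expR_ge0.
  - apply/measurable_EFinP; apply: measurable_funM => //.
    apply: measurable_funX; apply: measurable_funB => //.
    exact: measurable_gen_gauss_ratio.
  - by move=> x _; rewrite mule_ge0 ?adde_ge0 ?D0// lee_fin mulr_ge0.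
  - by apply: measurable_funeM; apply: emeasurable_funD; exact: mDE.
  (* The pointwise bound excludes the origin, where the exponent [2 (g - p)] may be negative; the
     exceptional set is a null set. *)
  - exists [set 0 : R]; split => //; first exact: lebesgue_measure_set1.
    move=> x /= h; apply: contra_notP h => /eqP x0 _.
    rewrite -EFinD -EFinM lee_fin (le_trans (HC m x m01 x0))//.
    by rewrite /D powRr0 le_eqVlt; apply/orP; left; apply/eqP; ring.
rewrite ge0_integralZl//; last 3 first.
- by apply: emeasurable_funD; exact: mDE.
- by move=> x _; rewrite adde_ge0.
- by rewrite lee_fin mulr_ge0.
rewrite ge0_integralD//; [|exact: mDE|exact: mDE].
rewrite -(fineK D1oo) -(fineK D2oo) -EFinD -EFinM lee_fin.
by rewrite le_eqVlt; apply/orP; left; apply/eqP; rewrite /I; ring.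
Qed.

(** Both bounds matter: the real-valued normalising integral would collapse to 0 if the extended one
    were infinite. Positivity comes from the constant lower bound [expR (- g^-1)] on the unit
    interval. *)
Lemma integral_gen_gauss_fun (R : realType) (g : R) : 0 < g ->
  (0 < \int[lebesgue_measure]_x (gen_gauss_fun g x)%:E < +oo)%E.
Proof.
move=> g0; have mg : measurable_fun [set: R] (gen_gauss_fun g) by exact: measurable_gen_gauss_fun.
have gg0 x : (0 <= (gen_gauss_fun g x)%:E)%E by rewrite lee_fin expR_ge0.
apply/andP; split; last first.
  have := @integral_powR_expR_lty R 0 g^-1 g ltac:(lra) ltac:(by rewrite invr_gt0) g0.
  under eq_integral do rewrite powRr0 mul1r mulrC.
  by [].
apply: (@lt_le_trans _ _ (\int[lebesgue_measure]_(x in `[0%R, 1%R]) (expR (- g^-1))%:E)%E).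
  rewrite integral_cst//= lebesgue_measure_itv/= lte01 oppr0 adde0 mule1.
  by rewrite lte_fin expR_gt0.
apply: (@le_trans _ _ (\int[lebesgue_measure]_(x in `[0%R, 1%R]) (gen_gauss_fun g x)%:E)%E).
  apply: ge0_le_integral => //.
  - by apply: measurable_funTS; exact/measurable_EFinP.
  - move=> x /=; rewrite in_itv/= => /andP[x0 x1].
    rewrite lee_fin ler_expR lerN2 -[leRHS]mul1r ler_wpM2r ?invr_ge0 ?(ltW g0)//.
    have <- : 1 `^ g = 1 :> R by rewrite powR1.
    by rewrite ger0_norm// ge0_ler_powR ?nnegrE ?(ltW g0).
by apply: ge0_subset_integral => //; exact/measurable_EFinP.
Qed.

(** * Marginal densities under the null and under the mixture *)

Section coordinate_density.
Context (R : realType) (n : nat).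
Local Notation mu := (@lebesgue_measure R).
Variables (Q : probability (n.-tuple R) R) (i : 'I_n) (f : R -> R).
Hypotheses (mf : measurable_fun [set: R] f) (f0 : forall x, 0 <= f x).
Hypothesis Qf : forall x : R, Q [set t | tnth t i <= x] =
  (\int[mu]_(y in `]-oo, x]) (f y)%:E)%E.

Let mf' : measurable_fun [set: measurableTypeR R] f. Proof. exact: mf. Qed.

Let mti : measurable_fun [set: n.-tuple R]
  ((fun t => tnth t i) : n.-tuple R -> measurableTypeR R).
Proof. exact: (@measurable_tnth _ R n i). Qed.

Lemma coordinate_densityE (A : set R) : measurable A ->
  Q [set t | A (tnth t i)] = (\int[mu]_(x in A) (f x)%:E)%E.
Proof.
move=> mA; have mti' := mti.
transitivity (pushforward Q ((fun t => tnth t i) : n.-tuple R -> measurableTypeR R) A).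
  by [].
transitivity (density_measure mu mf' f0 A); last by [].
move: A mA; apply: measure_eq_on_halflines; rewrite /pushforward/=.
  exact: le_lt_trans (probability_le1 Q measurableT) (ltry _).
move=> x; rewrite /density_measure -Qf; congr (Q _).
Qed.

Lemma integral_coordinate_density (h : R -> R) :
  measurable_fun [set: R] h -> (forall x, 0 <= h x) ->
  (\int[Q]_t (h (tnth t i))%:E = \int[mu]_x (h x * f x)%:E)%E.
Proof.
move=> mh h0; have mti' := mti.
have mh' : measurable_fun [set: measurableTypeR R] (fun x => (h x)%:E).
  by apply/measurable_EFinP; exact: mh.
transitivity (\int[pushforward Q ((fun t => tnth t i) : n.-tuple R -> measurableTypeR R)]_x
   (h x)%:E)%E.
  rewrite (ge0_integral_pushforward mti')//.
  by move=> x _; rewrite lee_fin.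
transitivity (\int[density_measure mu mf' f0]_x (h x)%:E)%E.
  by apply: eq_measure_integral => A mA _; exact: coordinate_densityE.
by rewrite ge0_integral_density_measure// => x; rewrite lee_fin.
Qed.

End coordinate_density.

Section gen_gauss_density.
Context {R : realType} (g : R) (g0 : 0 < g).
Local Notation mu := (@lebesgue_measure R).
Local Notation Z := (\int[mu]_y gen_gauss_fun g y).

Lemma gen_gauss_norm_gt0 : 0 < Z.
Proof. by apply: fine_gt0; exact: integral_gen_gauss_fun. Qed.

Lemma gen_gauss_pdf_gt0 x : 0 < gen_gauss_pdf g x.
Proof. by rewrite divr_gt0 ?expR_gt0 ?gen_gauss_norm_gt0. Qed.

Lemma measurable_gen_gauss_pdf : measurable_fun [set: R] (gen_gauss_pdf g).
Proof. by apply: measurable_funM => //; exact: measurable_gen_gauss_fun. Qed.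

Let mpE : measurable_fun [set: measurableTypeR R] (fun x => (gen_gauss_pdf g x)%:E).
Proof. by apply/measurable_EFinP; exact: measurable_gen_gauss_pdf. Qed.

Let pE0 x : (0 <= (gen_gauss_pdf g x)%:E)%E.
Proof. by rewrite lee_fin ltW ?gen_gauss_pdf_gt0. Qed.

Lemma integral_gen_gauss_pdf_lty : (\int[mu]_x (gen_gauss_pdf g x)%:E < +oo)%E.
Proof.
have /andP[_ oo] := integral_gen_gauss_fun g0.
have mE : measurable_fun [set: measurableTypeR R] (fun x => (gen_gauss_fun g x)%:E).
  by apply/measurable_EFinP; exact: measurable_gen_gauss_fun.
under eq_integral do rewrite EFinM.
rewrite ge0_integralZr//.
- by rewrite muleC lte_mul_pinfty// lee_fin invr_ge0 (ltW gen_gauss_norm_gt0).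
- by move=> x _; rewrite lee_fin expR_ge0.
- by rewrite lee_fin invr_ge0 (ltW gen_gauss_norm_gt0).
Qed.

Lemma gen_gauss_cdfE x :
  (gen_gauss_cdf g x)%:E = (\int[mu]_(y in `]-oo, x]) (gen_gauss_pdf g y)%:E)%E.
Proof.
rewrite /gen_gauss_cdf /Rintegral fineK// ge0_fin_numE; last exact: integral_ge0.
apply: le_lt_trans integral_gen_gauss_pdf_lty.
by apply: ge0_subset_integral.
Qed.

(** Translation invariance turns [G (x - m)] into an integral of the shifted density over the same
    half-line; positivity of the density then lets the null density be factored out, which exhibits
    the likelihood ratio. *)
Lemma gen_gauss_mixture_cdfE (e m x : R) : 0 <= e <= 1 ->
  (mixture_cdf (gen_gauss_cdf g) (gen_gauss_cdf g) e m x)%:E =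
  (\int[mu]_(y in `]-oo, x])
    ((1 - e + e * (gen_gauss_fun g (y - m) / gen_gauss_fun g y)) * gen_gauss_pdf g y)%:E)%E.
Proof.
move=> /andP[e0 e1]; rewrite /mixture_cdf EFinD !EFinM !gen_gauss_cdfE.
have mS (D : set (measurableTypeR R)) :
    measurable_fun D (fun x => (gen_gauss_pdf g x)%:E) by exact: measurable_funTS.
have mSm (D : set (measurableTypeR R)) :
    measurable_fun D (fun x : R => (gen_gauss_pdf g (x - m))%:E).
  apply: measurable_funTS; apply/measurable_EFinP.
  apply: (measurableT_comp measurable_gen_gauss_pdf); exact: measurable_funB.
rewrite -(@ge0_integral_shift _ m `]-oo, x - m]%classic (fun y => (gen_gauss_pdf g y)%:E))//.
rewrite (_ : _ @^-1` _ = `]-oo, x]%classic); last first.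
  by apply/seteqP; split=> y /=; rewrite !in_itv/= lerD2r.
rewrite -!ge0_integralZl//= ?lee_fin ?subr_ge0//.
rewrite -ge0_integralD//=.
- apply: eq_integral => y _; rewrite -!EFinM -EFinD; congr EFin.
  rewrite /gen_gauss_pdf.
  by field; rewrite !gt_eqF ?expR_gt0 ?gen_gauss_norm_gt0.
- by move=> y _; rewrite mule_ge0// lee_fin subr_ge0.
- exact: measurable_funeM.
- by move=> y _; rewrite mule_ge0.
- exact: measurable_funeM.
Qed.

End gen_gauss_density.

(** [C] depends only on [g] and [p], so the bound can be used along sequences [e = eps_n],
    [m = mu_n]. *)
Lemma gen_gauss_tv_dist_le (R : realType) (g p : R) : 0 < g -> 0 < p <= 1 ->
    p < 1 / 2 + g ->
  exists2 C : R, 0 < C & forall (n : nat) (e m : R) (Q0 Q1 : probability (n.-tuple R) R),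
    0 <= e <= 1 -> 0 < m <= 1 ->
    iid_joint_law (gen_gauss_cdf g) Q0 ->
    iid_joint_law (mixture_cdf (gen_gauss_cdf g) (gen_gauss_cdf g) e m) Q1 ->
    forall d : R, 0 < d ->
    (tv_dist Q0 Q1 <=
      (d / 2 + ((1 + C * (e ^+ 2 * m `^ (2 * p))) ^+ n - 1) / (2 * d))%:E)%E.
Proof.
move=> g0 p01 pg; have [C C0 HC] := integral_gen_gauss_chi2 g0 p01 pg.
pose Z := \int[lebesgue_measure]_y gen_gauss_fun g y.
have Z0 : 0 < Z by exact: gen_gauss_norm_gt0.
(* Adding 1 makes the constant strictly positive. The factor [1 / Z] appears because the chi-square
   integral was bounded for the unnormalised density. *)
exists ((C + 1) / Z); first by rewrite divr_gt0// ltr_wpDl.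
move=> n e m Q0 Q1 e01 m01 [Q0F Q0E] [Q1F Q1E] d d0.
pose l (x : R) := 1 - e + e * (gen_gauss_fun g (x - m) / gen_gauss_fun g x).
pose P := gen_gauss_pdf g; have mP := measurable_gen_gauss_pdf g.
have P0 x : 0 <= P x by rewrite ltW// gen_gauss_pdf_gt0.
have mgg := measurable_gen_gauss_fun g.
have ml : measurable_fun [set: R] l.
  apply: measurable_funD => //; apply: measurable_funM => //.
  exact: measurable_gen_gauss_ratio.
have l0 x : 0 <= l x.
  case/andP: e01 => e0 e1.
  by rewrite addr_ge0 ?subr_ge0// mulr_ge0// divr_ge0 ?expR_ge0.
have Q0P i x : Q0 [set t | tnth t i <= x] = (\int[lebesgue_measure]_(y in `]-oo, x]) (P y)%:E)%E.
  by rewrite Q0F gen_gauss_cdfE.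
have mlP : measurable_fun [set: R] (fun x => l x * P x) by exact: measurable_funM.
have lP0 x : 0 <= l x * P x by rewrite mulr_ge0.
have Q1P i x : Q1 [set t | tnth t i <= x] =
    (\int[lebesgue_measure]_(y in `]-oo, x]) (l y * P y)%:E)%E.
  by rewrite Q1F gen_gauss_mixture_cdfE.
apply: (tv_dist_iid_le Q0E Q1E ml l0) => // i.
- move=> A mA; rewrite (coordinate_densityE mlP lP0 (Q1P i))//.
  rewrite (integral_coordinate_density mP P0 (Q0P i) (h := fun x => \1_A x * l x))//.
  + rewrite integral_mkcond; apply: eq_integral => x _.
    by rewrite epatch_indic/= -EFinM; congr EFin; rewrite mulrC mulrA.
  + by apply: measurable_funM => //; exact: measurable_indic.
  + by move=> x; rewrite mulr_ge0.
- rewrite (integral_coordinate_density mP P0 (Q0P i) (h := fun x => (l x - 1) ^+ 2))//; last 2 first.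
  + by apply: measurable_funX; exact: measurable_funB.
  + by move=> x; exact: sqr_ge0.
  have k0 : 0 <= e ^+ 2 / Z by rewrite divr_ge0 ?sqr_ge0// ltW.
  rewrite (_ : (fun x => _) = (fun x => ((e ^+ 2 / Z)%:E *
     ((gen_gauss_fun g (x - m) / gen_gauss_fun g x - 1) ^+ 2 * gen_gauss_fun g x)%:E)%E)); last first.
    apply/funext => x; rewrite -EFinM; congr EFin; rewrite /l /P /gen_gauss_pdf -/Z.
    by field; rewrite !gt_eqF ?expR_gt0.
  rewrite ge0_integralZl//.
  + apply: (le_trans (lee_wpmul2l _ (HC m m01))); first by rewrite lee_fin.
    rewrite -EFinM lee_fin.
    rewrite (_ : (C + 1) / Z * _ = e ^+ 2 / Z * ((C + 1) * m `^ (2 * p))); last by ring.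
    by rewrite ler_wpM2l// ler_wpM2r ?powR_ge0// lerDl.
  + apply/measurable_EFinP; apply: measurable_funM => //; apply: measurable_funX.
    by apply: measurable_funB => //; exact: measurable_gen_gauss_ratio.
  + by move=> x _; rewrite lee_fin mulr_ge0 ?sqr_ge0 ?expR_ge0.
Qed.

(** * Asymptotics *)

Lemma cvg_natr_powRN (R : realType) (k : R) : 0 < k ->
  (n%:R : R) `^ (- k) @[n --> \oo] --> (0 : R).
Proof.
move=> k0; have ny : (n%:R : R) `^ k @[n --> \oo] --> +oo%R.
  apply/cvgryPge => A; near=> n.
  have AE : (`|A| `^ k^-1) `^ k = `|A| by rewrite -powRrM mulVf ?lt0r_neq0// powRr1.
  rewrite (le_trans (ler_norm A))// -AE.
  rewrite ge0_ler_powR ?nnegrE ?powR_ge0 ?(ltW k0)//.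
  by near: n; exact: nbhs_infty_ger.
under eq_fun do rewrite powRN.
apply/gtr0_cvgV0 => //; near=> n; rewrite powR_gt0// ltr0n.
by near: n; exact: nbhs_infty_gt.
Unshelve. all: by end_near. Qed.

(** The last condition reads [t < p], so a [p] exists once [t < B], and the midpoint is taken. For
    [gamma >= 1/2] the minimum [B] is 1 and [t < 1] is [s < beta]; for [gamma < 1/2] it is
    [1/2 + gamma], and [t < B] is the second inequality on [s] rearranged. *)
Lemma chi2_exponent_exists (R : realType) (gamma beta s : R) :
  0 < gamma -> 0 < beta < 1 / 2 -> 0 < s < 1 / 2 ->
  (1 / 2 <= gamma /\ s < beta) \/
  (gamma < 1 / 2 /\ s < 1 / 2 - (1 - 2 * beta) / (1 + 2 * gamma)) ->
  exists p : R, [/\ 0 < p < 1, p < 1 / 2 + gamma & 1 - 2 * beta < (1 - 2 * s) * p].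
Proof.
move=> g0 /andP[b0 b1] /andP[s0 s1] hregion; pose t := (1 - 2 * beta) / (1 - 2 * s).
have ts : t * (1 - 2 * s) = 1 - 2 * beta by rewrite /t divfK// gt_eqF; lra.
have t0 : 0 < t by rewrite divr_gt0; lra.
pose B := Num.min 1 (1 / 2 + gamma).
have tB : t < B.
  rewrite lt_min !ltr_pdivrMr; [|lra|lra].
  case: hregion => -[hg hs]; first by apply/andP; split; [lra|nra].
  have h1 : (1 - 2 * beta) < (1 / 2 - s) * (1 + 2 * gamma).
    by rewrite -ltr_pdivrMr; lra.
  by apply/andP; split; [nra|lra].
have B1 : B <= 1 by rewrite ge_min lexx.
have Bg : B <= 1 / 2 + gamma by rewrite ge_min lexx orbT.
by exists ((t + B) / 2); split; [apply/andP; split; lra|lra|nra].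
Qed.

Lemma tv_dist_ge0 d (T : measurableType d) (R : realType) (P Q : probability T R) :
  (0 <= tv_dist P Q)%E.
Proof.
apply: le_ereal_sup_tmp; exists 0%E => //; exists set0 => //.
by rewrite !measure0 subee// abse0.
Qed.

Theorem proposition1 (R : realType) (gamma beta s : R)
    (hgamma : 0 < gamma)
    (hbeta : 0 < beta < 1 / 2)
    (hs : 0 < s < 1 / 2)
    (hregion : (1 / 2 <= gamma /\ s < beta) \/
       (gamma < 1 / 2 /\
        s < 1 / 2 - (1 - 2 * beta) / (1 + 2 * gamma))) :
  merge_asymptotically (gen_gauss_cdf gamma) (gen_gauss_cdf gamma)
    (fun n : nat => n%:R `^ (- beta))
    (fun n : nat => n%:R `^ (s - 1 / 2)).
Proof.
have [p [p01 pg hp]] := chi2_exponent_exists hgamma hbeta hs hregion.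
have p01' : 0 < p <= 1 by case/andP: p01 => -> /ltW ->.
have [C C0 HC] := gen_gauss_tv_dist_le hgamma p01' pg.
move=> Q0 Q1 Q0F Q1F.
(* The exponent is such that [n * eps_n^2 * mu_n^(2 p) = n^(- k)]. *)
pose k := (1 - 2 * s) * p - (1 - 2 * beta); have k0 : 0 < k by rewrite /k; lra.
(* By [1 + v <= expR v], this dominates [(1 + v)^n - 1] when [n v = C n^(- k)]. *)
pose w n : R := expR (C * n%:R `^ (- k)) - 1.
have sqrt_w0 : Num.sqrt (w n) @[n --> \oo] --> (0 : R).
  have w0 : w n @[n --> \oo] --> expR (C * 0) - 1.
    apply: cvgB; last exact: cvg_cst.
    apply: continuous_cvg; first exact: continuous_expR.
    by apply: cvgM; [exact: cvg_cst|exact: cvg_natr_powRN].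
  rewrite mulr0 expR0 subrr in w0; rewrite -(sqrtr0 R).
  by apply: continuous_cvg w0; exact: sqrt_continuous.
apply: (@squeeze_cvge _ _ _ _ (fun=> 0%E) _ (fun n => (Num.sqrt (w n))%:E)); last 2 first.
- exact: cvg_cst.
- by apply: cvg_EFin => //; exact: nearW.
near=> n; rewrite tv_dist_ge0/=.
(* The hypotheses constrain the laws only for positive [n], and [w n > 0] also relies on it. *)
have n0 : (0 < n)%N by near: n; exact: nbhs_infty_gt.
have n1 : 1 <= n%:R :> R by rewrite ler1n.
have nr0 : 0 < n%:R :> R by rewrite ltr0n.
have powN_le1 a : a <= 0 -> (n%:R : R) `^ a <= 1.
  by move=> a0; rewrite -[leRHS](powRr0 n%:R) ler_powR.
have wn0 : 0 < w n by rewrite subr_gt0 expR_gt1 mulr_gt0// powR_gt0.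
have sw0 : 0 < Num.sqrt (w n) by rewrite sqrtr_gt0.
case/andP: hbeta => b0 b1; case/andP: hs => s0 s1.
have e01 : 0 <= (n%:R : R) `^ (- beta) <= 1 by rewrite powR_ge0 powN_le1//; lra.
have m01 : 0 < (n%:R : R) `^ (s - 1 / 2) <= 1 by rewrite powR_gt0//= powN_le1//; lra.
(* Taking [d] to be the square root of [w n] minimises [d / 2 + w n / (2 d)], and the two terms add
   up to that square root. *)
apply: (le_trans (HC n _ _ _ _ e01 m01 (Q0F n n0) (Q1F n n0) _ sw0)).
set v := C * _; rewrite lee_fin.
have v0 : 0 <= v by rewrite mulr_ge0 ?(ltW C0)// mulr_ge0 ?sqr_ge0 ?powR_ge0.
have nv : n%:R * v = C * n%:R `^ (- k).
  rewrite /v mulrCA; congr (C * _).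
  transitivity (n%:R `^ 1 * (n%:R `^ (- beta * 2%:R) * n%:R `^ ((s - 1 / 2) * (2 * p))) : R).
    by rewrite powRr1 ?(ltW nr0)// !(powRrM n%:R) powR_mulrn ?powR_ge0.
  by rewrite -!powRD ?(gt_eqF nr0) ?implybT//; congr (_ `^ _); rewrite /k; field.
have vw : (1 + v) ^+ n - 1 <= w n.
  rewrite lerD2r -nv expRM_natl lerXn2r// ?nnegrE ?addr_ge0 ?expR_ge0//.
  exact: expR_ge1Dx.
apply: (@le_trans _ _ (Num.sqrt (w n) / 2 + w n / (2 * Num.sqrt (w n)))).
  by rewrite lerD2l ler_wpM2r// invr_ge0 mulr_ge0// ltW.
rewrite -[X in X / (2 * _)](sqr_sqrtr (ltW wn0)) le_eqVlt; apply/orP; left.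
by apply/eqP; field; rewrite gt_eqF.
Unshelve. all: by end_near. Qed.
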